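(* Let $r\ge 2$ be the order of a conference matrix, and let $k$ be the order of an Hadamard matrix. If $p\ge 1$ is a real number, then there exists an $r$-partite matrix $A$ of order $n=rk$ with $\|A\|_{\max}=1$ such that $$\|A\|_p=n^{1/2+1/p}\sqrt{1-1/r}.$$
   Context: Matrices are complex. $\|A\|_{\max}:=\max_{i,j}|a_{i,j}|$. For an $n\times n$ matrix $A$ with singular values $\sigma_1\ge\cdots\ge\sigma_n$, the Schatten $p$-norm is $\|A\|_p:=(\sigma_1^p+\cdots+\sigma_n^p)^{1/p}$. An Hadamard matrix of order $k$ is a $k\times k$ matrix $H$ with entries of modulus $1$ such that $HH^*=kI_k$. A conference matrix of order $r$ is an $r\times r$ matrix $C$ with zero diagonal and off-diagonal entries of modulus $1$ such that $CC^*=(r-1)I_r$. An $n\times n$ matrix $A$ is called $r$-partite if there is a partition $[n]=\{1,\dots,n\}=N_1\cup\cdots\cup N_r$ of its index set into $r$ nonempty sets such that for every $i\in\{1,\dots,r\}$ the submatrix $A[N_i,N_i]$ of all entries with both indices in $N_i$ is zero. *)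

(* Defs.v *)
From mathcomp Require Import all_boot all_order all_algebra.
From mathcomp Require Import complex.
From mathcomp Require Import reals normedtype exp.

Set Implicit Arguments.
Unset Strict Implicit.
Unset Printing Implicit Defensive.

Import Order.TTheory GRing.Theory Num.Theory.

Local Open Scope ring_scope.
Local Open Scope complex_scope.
Local Open Scope sesquilinear_scope.

Definition hadamard_mx (R : realType) (k : nat) (H : 'M[R[i]]_k) : Prop :=
  (forall i j, `|H i j| = 1) /\ H *m H^t* = k%:R%:M.

Definition conference_mx (R : realType) (r : nat) (C : 'M[R[i]]_r) : Prop :=
  [/\ forall i, C i i = 0,
      forall i j, i != j -> `|C i j| = 1
    & C *m C^t* = (r%:R - 1)%:M].

(* [partition] already excludes the empty block. *)
Definition partite_mx (R : realType) (r n : nat) (A : 'M[R[i]]_n) : Prop :=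
  exists P : {set {set 'I_n}},
    [/\ partition P [set: 'I_n], #|P| = r
      & forall N, N \in P -> {in N &, forall i j, A i j = 0}].

(* The square roots of the eigenvalues of A^* A, with multiplicity, in
   decreasing order. Since A^* A is Hermitian, [spectral_diag] lists its
   eigenvalues and these are real and nonnegative, so that [complex.Re] loses
   nothing; see [char_poly_singular_values]. *)
Definition singular_values (R : realType) (n : nat) (A : 'M[R[i]]_n) : seq R :=
  sort >=%R
    [seq Num.sqrt (complex.Re (spectral_diag (A^t* *m A) 0 i)) | i : 'I_n].

Definition schatten_norm (R : realType) (p : R) (n : nat) (A : 'M[R[i]]_n) : R :=
  (\sum_(s <- singular_values A) s `^ p) `^ p^-1.

Lemma size_singular_values (R : realType) (n : nat) (A : 'M[R[i]]_n) :
  size (singular_values A) = n.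
Proof. by rewrite size_sort size_map -cardE card_ord. Qed.

Lemma singular_values_sorted (R : realType) (n : nat) (A : 'M[R[i]]_n) :
  sorted >=%R (singular_values A).
Proof. by apply: sort_sorted => x y; exact: le_total. Qed.

Lemma singular_values_ge0 (R : realType) (n : nat) (A : 'M[R[i]]_n) (s : R) :
  s \in singular_values A -> 0 <= s.
Proof. by rewrite mem_sort => /mapP[i _ ->]; exact: sqrtr_ge0. Qed.

Lemma char_poly_singular_values (R : realType) (n : nat) (A : 'M[R[i]]_n) :
  char_poly (A^t* *m A) =
  \prod_(s <- singular_values A) ('X - ((s ^+ 2)%:C)%:P).
Proof.
set B := A^t* *m A.
have BN : B \is normalmx.
  by apply/normalmxP; rewrite /B trmx_mul map_mxM trmxCK.
set P := spectralmx B; set d := spectral_diag B.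
have Pu : P \in unitmx := spectral_unit B.
have PP : invmx P = P^t* by rewrite invmx_unitary ?spectral_unitarymx.
have Bd : B = invmx P *m diag_mx d *m P by apply/orthomx_spectralP.
have dE : diag_mx d = (A *m P^t*)^t* *m (A *m P^t*).
  rewrite trmx_mul map_mxM trmxCK -mulmxA [A^t* *m _]mulmxA -/B -PP Bd.
  by rewrite !mulmxA mulmxV // mul1mx mulmxK.
have d0 i : 0 <= d 0 i.
  have /matrixP /(_ i i) := dE; rewrite !mxE eqxx mulr1n => ->.
  by apply: sumr_ge0 => j _; rewrite !mxE mulrC mul_conjC_ge0.
have -> : char_poly B = \prod_i ('X - (d 0 i)%:P).
  have -> : char_poly B = char_poly (diag_mx d).
    rewrite {1}Bd /char_poly /char_poly_mx !map_mxM /=.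
    set Q := map_mx polyC P; set Q' := map_mx polyC (invmx P).
    have QQ' : Q' *m Q = 1%:M by rewrite -map_mxM /= mulVmx // map_mx1.
    rewrite -[X in X - _](_ : Q' *m 'X%:M *m Q = _); last first.
      by rewrite scalar_mxC -mulmxA QQ' mulmx1.
    rewrite -mulmxBl -mulmxBr !det_mulmx mulrAC -det_mulmx QQ' det1.
    by rewrite mul1r.
  rewrite char_poly_trig; last first.
    by apply/is_trig_mxP => i j ij; rewrite !mxE -val_eqE ltn_eqF.
  by apply: eq_bigr => i _; rewrite !mxE eqxx mulr1n.
rewrite (perm_big _ (permEl (perm_sort _ _))) big_map big_enum /=.
apply: eq_bigr => i _; congr ('X - _%:P).
have := d0 i; rewrite lecE /= => /andP[/eqP dI dR].
by rewrite sqr_sqrtr // -/B -/d {1}(complexE (d 0 i)) dI mulr0 addr0.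
Qed.

(* Main.v *)
Require Import Defs.
From mathcomp Require Import all_boot all_order all_algebra.
From mathcomp Require Import complex mxtens.
From mathcomp Require Import reals normedtype exp.

(** The matrix is the Kronecker product [A = C *t H] of a conference matrix [C]
    of order [r] and a Hadamard matrix [H] of order [k]. Its diagonal blocks
    are multiples of [C i i = 0], which makes it [r]-partite; every other entry
    is a product of two numbers of modulus 1. Since adjoints and products pass
    through the Kronecker product, [A A^*] is the scalar matrix
    [(r - 1) k = n (1 - 1/r)], with [n = r k], so all [n] singular values of
    [A] are equal to [Num.sqrt (n (1 - 1/r))] ([singular_values_scalar]) and the
    Schatten norm is [n^(1/p)] times this number ([schatten_norm_scalar]). *)

Set Implicit Arguments.
Unset Strict Implicit.
Unset Printing Implicit Defensive.

Import Order.TTheory GRing.Theory Num.Theory.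

Local Open Scope ring_scope.
Local Open Scope complex_scope.
Local Open Scope sesquilinear_scope.

Lemma tens_scalar_mxM (R : pzRingType) (m n : nat) (a b : R) :
  (a%:M : 'M_m) *t (b%:M : 'M_n) = (a * b)%:M.
Proof.
apply/matrixP => i j.
case: (mxtens_indexP i) => i1 i2; case: (mxtens_indexP j) => j1 j2.
rewrite tensmxE !mxE (can_eq (@mxtens_indexK m n)) xpair_eqE.
by case: eqP; case: eqP; rewrite ?mulr0n ?mul0r ?mulr0.
Qed.

(** The max norm of a nonzero matrix is attained at a nonzero entry; this holds
    over [R[i]], where the order is only partial. *)
Lemma mx_norm_unimodular (K : numDomainType) (m n : nat) (A : 'M[K]_(m, n)) :
  (forall i j, A i j = 0 \/ `|A i j| = 1) -> A != 0 -> mx_norm A = 1.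
Proof.
move=> A01 A0.
have N0 : mx_norm A != 0 by apply: contra_neq A0; exact: mx_norm_eq0.
have [[i j] /= E] := mx_norm_neq0 N0; rewrite E.
by case: (A01 i j) => // Aij; move: N0; rewrite E Aij normr0 eqxx.
Qed.

(** The parts are the fibers of the labelling [f]; surjectivity is what makes
    them nonempty and pairwise distinct, hence [r] in number. *)
Lemma partite_mx_fibers (R : realType) (r n : nat) (A : 'M[R[i]]_n)
    (f : 'I_n -> 'I_r) :
  (forall y, exists x, f x = y) ->
  (forall i j, f i = f j -> A i j = 0) -> partite_mx r A.
Proof.
move=> fS fA; pose F (y : 'I_r) := f @^-1: [set y].
have F_inj : injective F.
  move=> y z /setP E; have [x fx] := fS y.
  by move: (E x); rewrite !inE fx eqxx => /esym/eqP.
exists [set F y | y : 'I_r]; split; last 1 first.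
- move=> _ /imsetP[y _ ->] i j; rewrite !inE => /eqP fi /eqP fj.
  by apply: fA; rewrite fi fj.
- apply/and3P; split.
  + apply/eqP/setP => x; rewrite inE; apply/bigcupP.
    by exists (F (f x)); [exact: imset_f | rewrite !inE].
  + apply/trivIsetP => _ _ /imsetP[y _ ->] /imsetP[z _ ->] yz.
    rewrite -setI_eq0; apply: contraNT yz => /set0Pn[x].
    by rewrite !inE => /andP[/eqP-> /eqP->].
  + apply/imsetP => -[y _ /setP E]; have [x fx] := fS y.
    by move: (E x); rewrite !inE fx eqxx.
by rewrite card_imset // card_ord.
Qed.

(** The squares of the singular values are roots of the characteristic
    polynomial of [A^* A], here ['X - c] to the power [n], so each of them is
    [c]. *)
Lemma singular_values_scalar (R : realType) (n : nat) (A : 'M[R[i]]_n) (c : R) :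
  A^t* *m A = (c%:C)%:M -> singular_values A = nseq n (Num.sqrt c).
Proof.
move=> AA; rewrite -[RHS](congr1 (nseq^~ _) (size_singular_values A)).
apply/all_pred1P/allP => s sA /=.
have := char_poly_singular_values A; rewrite AA => E.
have : root (char_poly ((c%:C)%:M : 'M_n)) ((s ^+ 2)%:C).
  by apply/rootP; rewrite E (big_rem s sA) hornerM hornerXsubC subrr mul0r.
rewrite char_poly_trig; last first.
  by apply/is_trig_mxP => i j ij; rewrite !mxE -val_eqE ltn_eqF.
rewrite (eq_bigr (fun=> 'X - (c%:C)%:P)); last by move=> i _; rewrite !mxE eqxx.
rewrite prodr_const rootE horner_exp expf_eq0 hornerXsubC subr_eq0.
case/andP=> _ /eqP/complexI <-.
by rewrite sqrtr_sqr ger0_norm // (singular_values_ge0 sA).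
Qed.

(** A nonzero scalar [A A^*] makes [A^* / c] a right inverse of the square
    matrix [A], hence also a left inverse, so [A^* A] is the same scalar. *)
Lemma schatten_norm_scalar (R : realType) (p : R) (n : nat) (A : 'M[R[i]]_n)
    (c : R) :
  p != 0 -> A *m A^t* = (c%:C)%:M -> c != 0 ->
  schatten_norm p A = n%:R `^ p^-1 * Num.sqrt c.
Proof.
move=> p0 AA c0.
have cC0 : c%:C != 0 :> R[i] by rewrite (inj_eq (@complexI R)).
have AA' : A^t* *m A = (c%:C)%:M.
  have : A *m ((c%:C)^-1 *: A^t* ) = 1%:M.
    by rewrite -scalemxAr AA scale_scalar_mx mulVf.
  move/mulmx1C; rewrite -scalemxAl => /(congr1 ( *:%R c%:C)).
  by rewrite scalerA divff // scale1r scale_scalar_mx mulr1.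
rewrite /schatten_norm (singular_values_scalar AA') big_nseq iter_addr_0.
rewrite -(mulr_natl (_ `^ p)) powRM ?powR_ge0 ?ler0n // -powRrM mulfV //.
by rewrite powRr1 ?sqrtr_ge0.
Qed.

Theorem theorem4p41 (R : realType) (r k : nat) (p : R)
    (r_ge2 : (2 <= r)%N) (k_gt0 : (0 < k)%N)
    (hr : exists C : 'M[R[i]]_r, conference_mx C)
    (hk : exists H : 'M[R[i]]_k, hadamard_mx H)
    (p_ge1 : 1 <= p) :
  exists A : 'M[R[i]]_(r * k),
    [/\ partite_mx r A,
        mx_norm A = 1
      & schatten_norm p A =
        (r * k)%:R `^ (1 / 2 + 1 / p) * Num.sqrt (1 - 1 / r%:R)].
Proof.
have [C [C0 C1 CC]] := hr; have [H [H1 HH]] := hk.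
have r0 : r%:R != 0 :> R by rewrite pnatr_eq0; case: (r) r_ge2.
have k0 : k%:R != 0 :> R by rewrite pnatr_eq0 -lt0n.
have p0 : p != 0 by rewrite gt_eqF // (lt_le_trans ltr01).
pose c : R := (r%:R - 1) * k%:R.
have c0 : c != 0.
  by rewrite mulf_neq0 // subr_eq0 pnatr_eq1; case: (r) r_ge2 => [|[]].
have AA : (C *t H) *m (C *t H)^t* = (c%:C)%:M.
  rewrite trmx_tens map_mxT tensmx_mul CC HH tens_scalar_mxM.
  by congr _%:M; rewrite /c rmorphM rmorphB /= !rmorph_nat rmorph1.
exists (C *t H); split.
- apply: (@partite_mx_fibers _ _ _ _ (fun x => (mxtens_unindex x).1)).
    by move=> y; exists (mxtens_index (y, Ordinal k_gt0)); rewrite mxtens_indexK.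
  by move=> i j; rewrite mxE => ->; rewrite C0 mul0r.
- apply: mx_norm_unimodular => [i j|].
    rewrite mxE normrM H1 mulr1.
    case: (eqVneq (mxtens_unindex i).1 (mxtens_unindex j).1) => [->|/C1->].
      by left; rewrite C0 mul0r.
    by right.
  (* If A were zero, the diagonal of A A^* would give c = 0. *)
  apply: contra_neq c0 => A0.
  have i : 'I_(r * k) by apply: (@Ordinal _ 0); rewrite muln_gt0 k_gt0 ltnW.
  move/matrixP/(_ i i): AA; rewrite A0 mul0mx !mxE eqxx mulr1n.
  by move/esym/complexI.
rewrite (schatten_norm_scalar p0 AA c0).
rewrite powRD; last by rewrite natrM mulf_neq0 ?implybT.
rewrite !div1r powR12_sqrt ?ler0n // mulrC mulrAC; congr (_ * _).
rewrite -sqrtrM ?ler0n // natrM /c; congr Num.sqrt.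
by rewrite mulrBr mulr1 mulrAC divff // mul1r mulrBl mul1r.
Qed.
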